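(* Let $n\ge3$, and assume that $\operatorname{char}(K)\nmid n$. Then no dihedral group $D_n$ can occur as $G_{\mathcal L}$; that is, there is no finite set $\mathcal L$ of at least three pairwise skew lines in $\mathbb P^3_K$ such that $G_{\mathcal L}\cong D_n$.
   Context: $K$ is an algebraically closed field (of characteristic $0$, for which the hypothesis $\operatorname{char}(K)\nmid n$ is automatic, or positive). $D_n=\langle r,s\mid r^n=s^2=1,\ srs^{-1}=r^{-1}\rangle$ is the dihedral group of order $2n$. For three distinct pairwise skew (i.e. disjoint) lines $L_i,L_j,L_k$ in $\mathbb P^3_K$, the map $f_{ijk}:L_i\to L_j$ sends $p\in L_i$ to the unique intersection point of $L_j$ with the plane spanned by $p$ and $L_k$. For a finite set $\mathcal L$ of at least three pairwise skew lines, $C_{\mathcal L}$ is the groupoid whose objects are the lines of $\mathcal L$ and whose arrows are the maps $f_{ijk}$ (with $L_i,L_j,L_k\in\mathcal L$ distinct) together with all their possible compositions; the groups $\mathrm{Hom}_{C_{\mathcal L}}(L_i,L_i)\subseteq\mathrm{Aut}(L_i)\cong\mathrm{PGL}_2(K)$ are all isomorphic, and $G_{\mathcal L}$ denotes this common group. *)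

(* Defs.v *)
From HB Require Import structures.
From mathcomp Require Import all_boot all_order all_algebra.
From mathcomp Require Import all_fingroup all_solvable.
From mathcomp Require Import finmap.

Set Implicit Arguments.
Unset Strict Implicit.
Unset Printing Implicit Defensive.

Local Open Scope ring_scope.

(* Projective 3-space over K is the set of vector lines of K^4: projective
   points, lines and planes are the subspaces of K^4 of dimension 1, 2, 3. *)
Definition line (K : fieldType) := {L : {vspace 'rV[K]_4} | \dim L == 2%N}.

Definition point (K : fieldType) (L : line K) :=
  {p : {vspace 'rV[K]_4} | (\dim p == 1%N) && (p <= val L)%VS}.

(* No common projective point. *)
Definition skew_lines (K : fieldType) (L M : line K) : bool :=
  (val L :&: val M == 0)%VS.

(* Skew lines are automatically distinct, as a line meets itself. *)
Definition skew3 (K : fieldType) (Li Lj Lk : line K) : bool :=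
  [&& skew_lines Li Lj, skew_lines Li Lk & skew_lines Lj Lk].

Lemma line_proj_subproof (K : fieldType) (Li Lj Lk : line K)
    (h : skew3 Li Lj Lk) (p : point Li) :
  let q := ((val p + val Lk) :&: val Lj)%VS in
  (\dim q == 1%N) && (q <= val Lj)%VS.
Proof.
case/and3P: h => _ /eqP ik /eqP jk; case: p => p /= /andP[/eqP dp pLi].
have dLj : \dim (val Lj) = 2 by apply/eqP; exact: (valP Lj).
have dLk : \dim (val Lk) = 2 by apply/eqP; exact: (valP Lk).
rewrite capvSr andbT.
have pk : (p :&: val Lk = 0)%VS.
  by apply/eqP; rewrite -subv0 -ik capvS // subvv.
have dpk : \dim (p + val Lk) = 3 by rewrite dimv_disjoint_sum // dp dLk.
have djk : \dim (val Lj + val Lk) = 4 by rewrite dimv_disjoint_sum // dLj dLk.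
have ds : \dim (p + val Lk + val Lj) = 4.
  apply/eqP; rewrite eqn_leq; apply/andP; split.
    by apply: leq_trans (dimvS (subvf _)) _; rewrite dimvf.
  by rewrite -djk dimvS // addvC addvS // addvSr.
have := dimv_sum_cap (p + val Lk) (val Lj); rewrite ds dpk dLj => e.
by rewrite -(eqn_add2l 4) e.
Qed.

(* The map f_ijk : Li -> Lj, sending p to the intersection of Lj with the plane
   spanned by p and Lk. *)
Definition line_proj (K : fieldType) (Li Lj Lk : line K) (h : skew3 Li Lj Lk)
    (p : point Li) : point Lj :=
  exist _ ((val p + val Lk) :&: val Lj)%VS (line_proj_subproof h p).

Definition pairwise_skew (K : fieldType) (Ls : {fset line K}) : Prop :=
  forall L M : line K, L \in Ls -> M \in Ls -> L != M -> skew_lines L M.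

(* The arrows of the groupoid of Ls. Since line_proj with Li and Lj exchanged is
   inverse to line_proj, closing under composition also provides inverses. *)
Inductive arrow (K : fieldType) (Ls : {fset line K}) :
    forall L M : line K, (point L -> point M) -> Prop :=
| arrow_proj Li Lj Lk (h : skew3 Li Lj Lk) :
    Li \in Ls -> Lj \in Ls -> Lk \in Ls -> arrow Ls (line_proj h)
| arrow_id L : L \in Ls -> arrow Ls (@id (point L))
| arrow_comp L M N (f : point L -> point M) (g : point M -> point N) :
    arrow Ls f -> arrow Ls g -> arrow Ls (g \o f).

(* The group Hom(L, L) of the groupoid of Ls, with composition of maps as its
   law, is isomorphic to gT. *)
Definition vertex_group_isog (K : fieldType) (Ls : {fset line K}) (L : line K)
    (gT : finGroupType) : Prop :=
  exists phi : gT -> (point L -> point L),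
    [/\ injective phi,
        {morph phi : x y / (x * y)%g >-> x \o y} &
        forall g : point L -> point L, arrow Ls g <-> exists x, g = phi x].

(* Main.v *)
(* An element r of order dividing n, with n invertible in K, has exactly two
   fixed points on L, and D_n permutes them because <r> is normal.  Suppose they
   are exchanged.  Transporting them along the groupoid yields two special
   points on each line, permuted by all the maps f_ijk.  If f_ijk and f_ijl
   disagreed at a special point, the eight special points of L_i, L_j, L_k, L_l
   would satisfy collinearities (in one case those of the Moebius-Kantor
   configuration) that are incompatible with the lines being pairwise skew.
   Hence f_ijk does not depend on k at the special points, every loop at L fixes
   both of them, and the vertex group is diagonal, hence abelian, contradicting
   n >= 3. *)
Require Import Defs.
From HB Require Import structures.
From mathcomp Require Import all_boot all_order all_algebra.
From mathcomp Require Import all_fingroup all_solvable.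
From mathcomp Require Import finmap.
From mathcomp Require Import ring.
From Stdlib Require Import FunctionalExtensionality.

Set Implicit Arguments.
Unset Strict Implicit.
Unset Printing Implicit Defensive.

Import GRing.Theory.
Local Open Scope ring_scope.

(** * Skew lines, their points, and coordinates on a line *)

Lemma skew_lines_sym (K : fieldType) (L M : line K) :
  skew_lines L M = skew_lines M L.
Proof. by rewrite /skew_lines capvC. Qed.

Lemma skew_lines_irrefl (K : fieldType) (L : line K) : skew_lines L L = false.
Proof. by rewrite /skew_lines capvv -dimv_eq0; case: L => L /= /eqP ->. Qed.

Section PointsAndArrows.
Variable K : fieldType.
Implicit Types (L M N Li Lj Lk Ll : line K) (Ls : {fset line K}).

Lemma point_neq0 L (p : point L) : val p != 0%VS.
Proof. by rewrite -dimv_eq0; case: p => p /= /andP[/eqP -> _]. Qed.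

Lemma point_sub L (p : point L) : (val p <= val L)%VS.
Proof. by case: p => p /= /andP[]. Qed.

Lemma point_dim L (p : point L) : \dim (val p) = 1.
Proof. by case: p => p /= /andP[/eqP]. Qed.

Lemma point_subE L M (p : point L) (q : point M) :
  (val p <= val q)%VS -> val p = val q.
Proof.
by move=> s; apply/eqP; rewrite eqEdim s !point_dim.
Qed.

Lemma point_cap L (p q : point L) : p != q -> (val p :&: val q = 0)%VS.
Proof.
move=> pq; apply/eqP; rewrite -dimv_eq0 -leqn0 leqNgt; apply/negP => d.
have e : (val p :&: val q)%VS = val p.
  by apply/eqP; rewrite eqEdim capvSl point_dim.
by case/negP: pq; apply/eqP/val_inj/point_subE; rewrite -e capvSr.
Qed.

Lemma vline_pointP L (v : 'rV[K]_4) :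
  v \in val L -> v != 0 -> (\dim <[v]>%VS == 1%N) && (<[v]> <= val L)%VS.
Proof. by move=> vL v0; rewrite dim_vline v0 -memvE vL. Qed.

Definition vpoint L v (vL : v \in val L) (v0 : v != 0) : point L :=
  exist _ <[v]>%VS (vline_pointP vL v0).

Lemma pointP L (p : point L) :
  exists2 v, v \in val L & v != 0 /\ val p = <[v]>%VS.
Proof.
exists (vpick (val p)).
  by apply: (subvP (point_sub p)); rewrite memv_pick.
have v0 : vpick (val p) != 0 by rewrite vpick0 point_neq0.
split=> //; apply/eqP; rewrite eq_sym eqEdim -memvE memv_pick.
by rewrite dim_vline v0 point_dim.
Qed.

Lemma vline_eqP (u v : 'rV[K]_4) :
  <[u]>%VS = <[v]>%VS -> exists k, u = k *: v.
Proof. by move=> e; apply/vlineP; rewrite -e memv_line. Qed.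

Lemma line_basisP L (e : 'rV[K]_4) : e \in val L -> e != 0 ->
  exists2 f, f \in val L & f \notin <[e]>%VS /\ (val L = <[e]> + <[f]>)%VS.
Proof.
move=> eL e0.
have dL : \dim (val L) = 2 by apply/eqP; exact: (valP L).
have: ~~ (val L <= <[e]>)%VS.
  by apply/negP => /dimvS; rewrite dL dim_vline e0.
case/subvPn=> f fL fe; exists f => //; split=> //.
apply/eqP; rewrite eq_sym eqEdim dL subv_add -!memvE eL fL /=.
have f0 : f != 0 by apply: contraNneq fe => ->; rewrite mem0v.
rewrite dimv_disjoint_sum ?dim_vline ?e0 ?f0 //.
apply/eqP; rewrite -subv0; apply/subvP=> x; rewrite memv_cap memv0.
case/andP=> xe /vlineP[k xk]; have [k0|k0] := eqVneq k 0.
  by rewrite xk k0 scale0r.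
case/negP: fe; suff -> : f = k^-1 *: x by rewrite memvZ.
by rewrite xk scalerA mulVf // scale1r.
Qed.

Lemma line_coords L (e f v : 'rV[K]_4) : (val L = <[e]> + <[f]>)%VS ->
  v \in val L -> exists x y, v = x *: e + y *: f.
Proof.
by move=> -> /memv_addP[u /vlineP[x ->] [w /vlineP[y ->] ->]]; exists x, y.
Qed.

Lemma coords_eq0 (e f : 'rV[K]_4) (x y : K) : e != 0 -> f \notin <[e]>%VS ->
  x *: e + y *: f = 0 -> x = 0 /\ y = 0.
Proof.
move=> e0 fe xy; have [y0|y0] := eqVneq y 0.
  move: xy; rewrite y0 scale0r addr0 => /eqP.
  by rewrite scaler_eq0 (negbTE e0) orbF => /eqP.
case/negP: fe; apply/vlineP; exists (- (y^-1 * x)).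
apply/eqP; rewrite -subr_eq0 scaleNr opprK -scalerA.
by rewrite -[X in X + _]scale1r -(mulVf y0) -scalerA -scalerDr addrC xy scaler0.
Qed.

Lemma coords_inj (e f : 'rV[K]_4) (x y x' y' : K) :
  e != 0 -> f \notin <[e]>%VS ->
  x *: e + y *: f = x' *: e + y' *: f -> x = x' /\ y = y'.
Proof.
move=> e0 fe /eqP; rewrite -subr_eq0 => /eqP h.
have : (x - x') *: e + (y - y') *: f = 0.
  by rewrite -h !scalerBl opprD addrACA.
by case/(coords_eq0 e0 fe) => /eqP + /eqP; rewrite !subr_eq0 => /eqP-> /eqP->.
Qed.

(** Components along [U] and [W] are unique because [U] and [W] meet in 0. With skew lines for [U]
    and [W], two transversals can only meet at a shared end. *)
Lemma cap_add_sub (U W A A' B B' : {vspace 'rV[K]_4}) :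
  (U :&: W = 0)%VS -> (A <= U)%VS -> (A' <= U)%VS -> (B <= W)%VS ->
  (B' <= W)%VS -> ((A + B) :&: (A' + B') <= (A :&: A') + (B :&: B'))%VS.
Proof.
move=> UW /subvP AU /subvP AU' /subvP BW /subvP BW'.
apply/subvP=> x; rewrite memv_cap.
case/andP=> /memv_addP[a aA [b bB ->]] /memv_addP[a' aA' [b' bB' e]].
have z : a - a' \in (U :&: W)%VS.
  rewrite memv_cap rpredB; [|exact: AU|exact: AU'].
  have -> : a - a' = b' - b.
    by apply/eqP; rewrite subr_eq addrAC eq_sym subr_eq addrC e.
  by rewrite rpredB; [|exact: BW'|exact: BW].
have ea : a = a' by apply/eqP; move: z; rewrite UW memv0 subr_eq0.
have eb : b = b' by move: e; rewrite ea => /addrI.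
by rewrite memv_add // memv_cap ?aA ?bB /= ?ea ?eb ?aA' ?bB'.
Qed.

(** * Linear lifts of maps between lines *)

(** This makes [f] a projectivity. Only the restriction of [g] to [val L] matters; [g] may be
    singular on the whole space, as the projections below are. *)
Definition lifts L M (f : point L -> point M) (g : 'End('rV[K]_4)) :=
  forall p, val (f p) = (g @: val p)%VS.

Lemma lifts_vpoint L M (f : point L -> point M) g v
    (vL : v \in val L) (v0 : v != 0) :
  lifts f g -> val (f (vpoint vL v0)) = <[g v]>%VS.
Proof. by move=> ->; rewrite limg_line. Qed.

Lemma lifts_mem L M (f : point L -> point M) g v :
  lifts f g -> v \in val L -> g v \in val M.
Proof.
move=> lg vL; have [->|v0] := eqVneq v 0; first by rewrite linear0 mem0v.
by rewrite memvE -(lifts_vpoint vL v0 lg) point_sub.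
Qed.

Lemma lifts_neq0 L M (f : point L -> point M) g v :
  lifts f g -> v \in val L -> v != 0 -> g v != 0.
Proof.
move=> lg vL v0; apply: contraNneq (point_neq0 (f (vpoint vL v0))) => g0.
by rewrite (lifts_vpoint vL v0 lg) g0 -dimv_eq0 dim_vline eqxx.
Qed.

Lemma lifts_id L : lifts (@id (point L)) \1%VF.
Proof. by move=> p; rewrite lim1g. Qed.

Lemma lifts_comp L M N (f : point L -> point M) (f' : point M -> point N) g g' :
  lifts f g -> lifts f' g' -> lifts (f' \o f) (g' \o g)%VF.
Proof. by move=> lg lg' p; rewrite /= lg' lg limg_comp. Qed.

Lemma lifts_iter L (f : point L -> point L) g n :
  lifts f g -> exists2 h, lifts (iter n f) h & forall v, h v = iter n g v.
Proof.
move=> lg; elim: n => [|n [h lh hE]].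
  by exists \1%VF; [exact: lifts_id | move=> v; rewrite id_lfunE].
exists (g \o h)%VF; first exact: lifts_comp lh lg.
by move=> v; rewrite comp_lfunE hE.
Qed.

(** The space is the direct sum of [Lj] and [Lk], and the linear projection onto [Lj] along [Lk]
    moves a vector only by elements of [Lk], so it stays in the plane spanned by [p] and [Lk]. *)
Lemma line_proj_lifts Li Lj Lk (h : skew3 Li Lj Lk) :
  lifts (line_proj h) (daddv_pi (val Lj) (val Lk)).
Proof.
move=> p; case/and3P: (h) => _ _ /eqP jk; apply/eqP.
(* By rank-nullity the image of [p] has dimension at most 1, so one inclusion suffices. *)
rewrite eqEdim point_dim -(point_dim p).
rewrite -(limg_ker_dim (daddv_pi (val Lj) (val Lk)) (val p)) leq_addl andbT.
apply/subvP=> x /=; rewrite memv_cap => /andP[/memv_addP[y yp [z zk e]] xj].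
have kj : (val Lk :&: val Lj = 0)%VS by rewrite capvC.
have z0 : daddv_pi (val Lj) (val Lk) z = 0.
  apply: (addIr z); rewrite add0r -[X in _ + X](daddv_pi_id kj zk).
  by rewrite daddv_pi_add // (subvP (addvSr _ _)).
have <- : daddv_pi (val Lj) (val Lk) y = x.
  by rewrite -[RHS](daddv_pi_id jk xj) e linearD /= z0 addr0.
exact: memv_img.
Qed.
End PointsAndArrows.

(** * Incidences between the maps f_ijk and transversals *)

Lemma point_sub_exchange (K : fieldType) (L M : line K) (p : point L)
    (q : point M) (W : {vspace 'rV[K]_4}) :
  ~~ (val p <= W)%VS -> (val p <= val q + W)%VS -> (val q <= val p + W)%VS.
Proof.
have [a _ [_ ->]] := pointP p; have [b _ [_ ->]] := pointP q.
rewrite -!memvE => aW /memv_addP[u /vlineP[k ->] [w wW e]].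
have k0 : k != 0.
  by apply: contraNneq aW => k0; rewrite e k0 scale0r add0r.
have -> : b = k^-1 *: (a - w) by rewrite e addrK scalerA mulVf // scale1r.
by rewrite memvZ // memvB ?(subvP (addvSl _ _) _ (memv_line _)) //
  (subvP (addvSr _ _)).
Qed.

Lemma skew3_swap12 (K : fieldType) (Li Lj Lk : line K) :
  skew3 Li Lj Lk -> skew3 Lj Li Lk.
Proof. by case/and3P=> ij ik jk; rewrite /skew3 skew_lines_sym ij jk ik. Qed.

Lemma skew3_swap23 (K : fieldType) (Li Lj Lk : line K) :
  skew3 Li Lj Lk -> skew3 Li Lk Lj.
Proof. by case/and3P=> ij ik jk; rewrite /skew3 ij ik skew_lines_sym. Qed.

Lemma point_sub_skew (K : fieldType) (L M : line K) (p : point L) :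
  skew_lines L M -> ~~ (val p <= val M)%VS.
Proof.
move=> /eqP LM; apply: contra (point_neq0 p) => pM.
by rewrite -subv0 -LM subv_cap point_sub.
Qed.

Section LineProj.
Variable K : fieldType.
Implicit Types (L M N Li Lj Lk Ll : line K) (Ls : {fset line K}).

Lemma line_proj_unique Li Lj Lk (h : skew3 Li Lj Lk) (p : point Li)
    (q : point Lj) :
  (val q <= val p + val Lk)%VS -> line_proj h p = q.
Proof.
move=> s; apply/esym/val_inj/point_subE.
by rewrite subv_cap s point_sub.
Qed.

Lemma line_proj_sub Li Lj Lk (h : skew3 Li Lj Lk) (p : point Li) :
  (val (line_proj h p) <= val p + val Lk)%VS.
Proof. exact: capvSl. Qed.

(** By exchange, [p] lies in the plane spanned by its image and [Lk]. *)
Lemma line_projK Li Lj Lk (h : skew3 Li Lj Lk) (h' : skew3 Lj Li Lk) :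
  cancel (line_proj h) (line_proj h').
Proof.
move=> p; apply: line_proj_unique.
apply: point_sub_exchange (line_proj_sub h p).
by apply: point_sub_skew; case/and3P: (h).
Qed.

(** Both images lie on the transversal through [p] to [Lj] and [Lk]: if x = y + z with y in [p], z
    in [Lk] and x in [Lj], then z = x - y lies in the plane spanned by [p] and [Lj]. *)
Lemma line_proj_collinear Li Lj Lk (h : skew3 Li Lj Lk) (h' : skew3 Li Lk Lj)
    (p : point Li) :
  (val (line_proj h p) <= val p + val (line_proj h' p))%VS.
Proof.
apply/subvP=> x; rewrite memv_cap => /andP[/memv_addP[y yp [z zk e]] xj].
rewrite e memv_add // memv_cap zk andbT.
have -> : z = - y + x by rewrite e addKr.
by rewrite memv_add // rpredN.
Qed.

(** Both sides are the point of [Lk] on the transversal through [p] to [Lj] and [Lk]. *)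
Lemma line_proj_comp Li Lj Lk (h : skew3 Li Lj Lk) (h' : skew3 Lj Lk Li)
    (h'' : skew3 Li Lk Lj) (p : point Li) :
  line_proj h' (line_proj h p) = line_proj h'' p.
Proof.
apply: line_proj_unique; apply: subv_trans (line_proj_collinear h'' h p) _.
by rewrite addvC addvS // point_sub.
Qed.

(* [S] is meant to single out two points on each line.  If [f_ijk] and [f_ijl]
   disagreed at [p], with values [B] and [B'], they would exchange these values
   at [q].  With C = f_ikj p, C' = f_ikj q, D = f_ilj p and D' = f_ilj q, the
   transversal to Li, Lk, Ll through [p] meets Lk in C or C' and Ll in D or D',
   and each of the four cases contradicts the skewness of the lines. *)
Lemma line_proj_indep Ls (S : forall M, point M -> Prop) Li Lj Lk Ll
    (hk : skew3 Li Lj Lk) (hl : skew3 Li Lj Ll) (p q : point Li) :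
  (forall M N P (h : skew3 M N P) r, M \in Ls -> N \in Ls -> P \in Ls ->
     S M r -> S N (line_proj h r)) ->
  (forall M (r s t : point M), S M r -> S M s -> S M t -> r != s ->
     t = r \/ t = s) ->
  pairwise_skew Ls ->
  Li \in Ls -> Lj \in Ls -> Lk \in Ls -> Ll \in Ls ->
  S Li p -> S Li q -> p != q -> line_proj hk p = line_proj hl p.
Proof.
move=> Scl S2 sk iLs jLs kLs lLs Sp Sq pq.
have [kl|kl] := eqVneq Lk Ll.
  by subst Ll; rewrite (bool_irrelevance hk hl).
have {}kl := sk _ _ kLs lLs kl.
have /and3P[sij sik sjk] := hk; have /and3P[_ sil sjl] := hl.
have hkj := skew3_swap23 hk; have hlj := skew3_swap23 hl.
have hkl : skew3 Li Lk Ll by rewrite /skew3 sik sil.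
have hlk := skew3_swap23 hkl.
apply/eqP/negPn/negP => BB'.
have inj M N P (h : skew3 M N P) : injective (line_proj h).
  exact: can_inj (line_projK h (skew3_swap12 h)).
have SB : S Lj (line_proj hk p) by exact: Scl.
have SB' : S Lj (line_proj hl p) by exact: Scl.
have kq : line_proj hk q = line_proj hl p.
  have [|//] := S2 _ _ _ (line_proj hk q) SB SB'
    (Scl _ _ _ _ _ iLs jLs kLs Sq) BB'.
  by move/inj => e; rewrite e eqxx in pq.
have lq : line_proj hl q = line_proj hk p.
  have [//|] := S2 _ _ _ (line_proj hl q) SB SB'
    (Scl _ _ _ _ _ iLs jLs lLs Sq) BB'.
  by move/inj => e; rewrite e eqxx in pq.
have Bc := point_cap BB'; have pqc := point_cap pq.
have ij : (val Li :&: val Lj = 0)%VS by apply/eqP.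
have meet (X : {vspace 'rV[K]_4}) (a a' : point Li) (b b' : point Lj) :
    (X <= val a + val b)%VS -> (X <= val a' + val b')%VS ->
    (X <= (val a :&: val a') + (val b :&: val b'))%VS.
  move=> s s'; apply: subv_trans (cap_add_sub ij _ _ _ _); try exact: point_sub.
  by rewrite subv_cap s.
have C := line_proj_collinear hkj hk p.
have C' := line_proj_collinear hkj hk q; rewrite kq in C'.
have D := line_proj_collinear hlj hl p.
have D' := line_proj_collinear hlj hl q; rewrite lq in D'.
have F := line_proj_collinear hkl hlk p.
have E := line_proj_collinear hlk hkl p.
have FC :
    line_proj hkl p = line_proj hkj p \/ line_proj hkl p = line_proj hkj q.
  apply: (S2 _ _ _ _ (Scl _ _ _ _ _ iLs kLs jLs Sp)
    (Scl _ _ _ _ _ iLs kLs jLs Sq)).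
    exact: Scl.
  by rewrite (inj_eq (@inj _ _ _ _)).
have ED :
    line_proj hlk p = line_proj hlj p \/ line_proj hlk p = line_proj hlj q.
  apply: (S2 _ _ _ _ (Scl _ _ _ _ _ iLs lLs jLs Sp)
    (Scl _ _ _ _ _ iLs lLs jLs Sq)).
    exact: Scl.
  by rewrite (inj_eq (@inj _ _ _ _)).
have off M N (r : point M) (s : point N) :
    skew_lines M N -> (val r <= val s)%VS -> False.
  move=> MN rs; case/negP: (point_sub_skew r MN).
  exact: subv_trans rs (point_sub s).
case: FC ED => eF [] eE; rewrite eF eE in E F.
(* In the first three cases a point of [Lk] or [Ll] lies on two of the lines pB, pB', qB, qB' with a
   common end. It equals that end, which is on [Li] or [Lj]. *)
- apply: (off _ _ (line_proj hkj p) p); first by rewrite skew_lines_sym.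
  have s : (val (line_proj hkj p) <= val p + val (line_proj hl p))%VS.
    by apply: subv_trans F _; rewrite subv_add addvSl.
  by have := meet _ _ _ _ _ C s; rewrite capvv Bc addv0.
- apply: (off _ _ (line_proj hlj q) (line_proj hk p)).
    by rewrite skew_lines_sym.
  have s : (val (line_proj hlj q) <= val p + val (line_proj hk p))%VS.
    by apply: subv_trans E _; rewrite subv_add addvSl.
  by have := meet _ _ _ _ _ s D'; rewrite pqc capvv add0v.
- apply: (off _ _ (line_proj hkj q) (line_proj hl p)).
    by rewrite skew_lines_sym.
  have s : (val (line_proj hkj q) <= val p + val (line_proj hl p))%VS.
    by apply: subv_trans F _; rewrite subv_add addvSl.
  by have := meet _ _ _ _ _ s C'; rewrite pqc capvv add0v.
(* Here [p] lies on the line C'D'. Both C' and D' are in the plane spanned by [q] and [Lj], which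
   meets [Li] only in [q]. *)
- have pW : (val p <= val q + val Lj)%VS.
    have s : ~~ (val (line_proj hkj q) <= val (line_proj hlj q))%VS.
      by apply/negP; exact: off kl.
    apply: subv_trans (point_sub_exchange s F) _.
    rewrite subv_add (subv_trans C') ?(subv_trans D') //.
      by rewrite addvS // point_sub.
    by rewrite addvS // point_sub.
  case/negP: (point_neq0 p); rewrite -subv0.
  have := cap_add_sub ij (point_sub p) (point_sub q) (sub0v _) (subvv (val Lj)).
  by rewrite pqc cap0v !addv0; apply: subv_trans; rewrite subv_cap subvv.
Qed.
End LineProj.

(** * Fixed points of projectivities of a line *)

(** A fixed point is an eigenvector of [g] on [val L]. Either the second basis vector is one, or a
    root of a quadratic supplies it. *)
Lemma lifts_fixed_point (K : closedFieldType) (L : line K)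
    (f : point L -> point L) (g : 'End('rV[K]_4)) :
  lifts f g -> exists p, f p = p.
Proof.
move=> lg; have d2 : \dim (val L) = 2 by apply/eqP; exact: (valP L).
have e0 : vpick (val L) != 0 by rewrite vpick0 -dimv_eq0 d2.
have eL : vpick (val L) \in val L by rewrite memv_pick.
have [e2 e2L [e2e LE]] := line_basisP eL e0; set e1 := vpick _ in e0 eL e2e LE.
have e20 : e2 != 0 by apply: contraNneq e2e => ->; rewrite mem0v.
have eigen v (vL : v \in val L) (v0 : v != 0) k :
    g v = k *: v -> f (vpoint vL v0) = vpoint vL v0.
  move=> gv; apply/val_inj/point_subE.
  rewrite (lifts_vpoint vL v0 lg) -memvE gv.
  by rewrite memvZ // memv_line.
have [a [b g1]] := line_coords LE (lifts_mem lg eL).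
have [c [d g2]] := line_coords LE (lifts_mem lg e2L).
have [c0|c0] := eqVneq c 0.
  exists (vpoint e2L e20); apply: (eigen _ e2L e20 d).
  by rewrite g2 c0 scale0r add0r.
(* [e1 + t e2] is an eigenvector iff [c t^2 + (a - d) t - b = 0]. *)
have [t] := solve_monicpoly (fun i => if i == 0%N then b / c else (d - a) / c)
              (isT : (0 < 2)%N).
rewrite !big_ord_recl big_ord0 /= addr0 expr0 mulr1 expr1 => tE.
have vL : e1 + t *: e2 \in val L by rewrite rpredD // rpredZ.
have v0 : e1 + t *: e2 != 0.
  apply/eqP; rewrite -[e1 in e1 + _]scale1r => /(coords_eq0 e0 e2e)[/eqP].
  by rewrite oner_eq0.
exists (vpoint vL v0); apply: (eigen _ vL v0 (a + t * c)).
rewrite linearD linearZ /= g1 g2 !scalerDr !scalerA addrACA -!scalerDl.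
congr (_ + _ *: _); apply: (mulfI c0).
have -> : c * ((a + t * c) * t) = c * a * t + c * c * t ^+ 2 by ring.
by rewrite tE; field.
Qed.

Lemma lifts_eigen (K : fieldType) (L : line K) (f : point L -> point L)
    (g : 'End('rV[K]_4)) v (vL : v \in val L) (v0 : v != 0) :
  lifts f g -> f (vpoint vL v0) = vpoint vL v0 ->
  exists2 k, k != 0 & g v = k *: v.
Proof.
move=> lg /(congr1 val); rewrite (lifts_vpoint vL v0 lg) => /vline_eqP[k e].
exists k => //; apply: contra_eq_neq e => ->.
by rewrite scale0r (lifts_neq0 lg).
Qed.

(* The n-th power of a Jordan block [[l, u], [0, l]] is
   [[l^n, n l^(n-1) u], [0, l^n]], which is not scalar unless n u = 0. *)
Lemma finite_order_fixed_pair (K : closedFieldType) (L : line K)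
    (f : point L -> point L) (g : 'End('rV[K]_4)) (n : nat) :
  lifts f g -> n%:R != 0 :> K -> iter n f =1 id -> ~ f =1 id ->
  exists a b, [/\ a != b, f a = a, f b = b &
    forall p, f p = p -> p = a \/ p = b].
Proof.
move=> lg n0 fn f1; have [a fa] := lifts_fixed_point lg.
have [e eL [e0 aE]] := pointP a.
have {}fa : f (vpoint eL e0) = vpoint eL e0.
  suff <- : a = vpoint eL e0 by [].
  exact: val_inj.
have [l l0 ge] := lifts_eigen lg fa.
have [h hL [he LE]] := line_basisP eL e0.
have h0 : h != 0 by apply: contraNneq he => ->; rewrite mem0v.
have [u [m gh]] := line_coords LE (lifts_mem lg hL).
have [ml|ml] := eqVneq m l.
  suff u0 : u = 0.
    case: f1 => p0; have [v vL [v0 pE]] := pointP p0.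
    apply/val_inj/point_subE; rewrite lg pE limg_line -memvE.
    have [x [y ->]] := line_coords LE vL; apply/vlineP; exists l.
    rewrite linearD !linearZ /= ge gh u0 ml scale0r add0r scalerDr !scalerA.
    by rewrite [x * _]mulrC [y * _]mulrC.
  have [gn lgn gnE] := lifts_iter n lg.
  have gk k : iter k g e = l ^+ k *: e.
    elim: k => [|k IH]; first by rewrite scale1r.
    by rewrite iterS IH linearZ /= ge scalerA exprSr.
  (* The factor [l] avoids the exponent k - 1, which would be truncated at k = 0. *)
  have hk k : l *: iter k g h = (k%:R * l ^+ k * u) *: e + l ^+ k.+1 *: h.
    elim: k => [|k IH]; first by rewrite !mul0r scale0r add0r.
    rewrite iterS -linearZ /= IH linearD !linearZ /= ge gh ml.
    rewrite !scalerDr !scalerA addrA -scalerDl.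
    congr (_ *: _ + _ *: _); last by rewrite [RHS]exprSr.
    by rewrite -natr1 !exprSr; ring.
  have [k _] := lifts_eigen (vL := hL) (v0 := h0) lgn (fn _).
  rewrite gnE => /(congr1 (fun v => l *: v)); rewrite hk scalerA.
  rewrite -[X in _ = X]add0r -(scale0r e) => /(coords_inj e0 he)[/eqP + _].
  by rewrite !mulf_eq0 (negbTE n0) expf_eq0 (negbTE l0) andbF /= => /eqP.
(* Distinct eigenvalues: this correction of [h] is an eigenvector for [m]. *)
pose h' := h + (u / (m - l)) *: e.
have ml0 : m - l != 0 by rewrite subr_eq0.
have h'L : h' \in val L by rewrite rpredD // rpredZ.
have h'0 : h' != 0.
  rewrite /h' addrC -[h in _ + h]scale1r.
  by apply/eqP => /(coords_eq0 e0 he)[_ /eqP]; rewrite oner_eq0.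
have gh' : g h' = m *: h'.
  rewrite /h' linearD linearZ /= ge gh scalerDr !scalerA [RHS]addrC addrAC.
  by rewrite -scalerDl; congr (_ *: _ + _); field.
have he' : h' \notin <[e]>%VS.
  apply: contra he => /vlineP[k kE]; apply/vlineP; exists (k - u / (m - l)).
  by rewrite scalerBl -kE /h' addrK.
have LE' : (val L = <[e]> + <[h']>)%VS.
  apply/eqP; rewrite eqEsubv; apply/andP; split; last first.
    by rewrite subv_add -!memvE eL.
  rewrite LE subv_add addvSl -memvE.
  have -> : h = (- (u / (m - l))) *: e + h' by rewrite scaleNr /h' addrC addrK.
  by apply: memv_add; [apply/memvZ/memv_line | exact: memv_line].
clearbody h'; exists (vpoint eL e0), (vpoint h'L h'0); split=> //.
- apply/eqP => /(congr1 val) /= E; case/negP: he'.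
  by rewrite E memv_line.
- apply/val_inj/point_subE; rewrite (lifts_vpoint h'L h'0 lg) -memvE gh'.
  by rewrite memvZ // memv_line.
move=> p fp; have [v vL [v0 pE]] := pointP p.
have pv : p = vpoint vL v0 by exact: val_inj.
rewrite pv in fp *; have [k _ gv] := lifts_eigen lg fp.
have [x [y vE]] := line_coords LE' vL.
have : (x * l) *: e + (y * m) *: h' = (k * x) *: e + (k * y) *: h'.
  by move: gv; rewrite vE linearD !linearZ /= ge gh' scalerDr !scalerA.
case/(coords_inj e0 he') => xl ym.
(* An eigenvector with both coordinates nonzero would force m = k = l. *)
have [x0|x0] := eqVneq x 0.
  right; apply/val_inj/point_subE => /=; rewrite -memvE vE x0 scale0r add0r.
  by rewrite memvZ // memv_line.
have [y0|y0] := eqVneq y 0.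
  left; apply/val_inj/point_subE => /=; rewrite -memvE vE y0 scale0r addr0.
  by rewrite memvZ // memv_line.
case/negP: ml; apply/eqP; transitivity k.
  by apply: (mulfI y0); rewrite ym mulrC.
by apply: (mulfI x0); rewrite xl mulrC.
Qed.

(** Vectors spanning [a] and [b] form a basis of [val L] in which both lifts are diagonal. *)
Lemma lifts_common_fixed_comm (K : fieldType) (L : line K)
    (f1 f2 : point L -> point L) (g1 g2 : 'End('rV[K]_4)) (a b : point L) :
  lifts f1 g1 -> lifts f2 g2 -> a != b -> f1 a = a -> f1 b = b -> f2 a = a ->
  f2 b = b -> f1 \o f2 =1 f2 \o f1.
Proof.
move=> lg1 lg2 ab.
have [e eL [e0 aE]] := pointP a; have [h hL [h0 bE]] := pointP b.
have eqa : a = vpoint eL e0 by exact: val_inj.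
have eqb : b = vpoint hL h0 by exact: val_inj.
rewrite eqa eqb => f1a f1b f2a f2b.
have [x1 _ g1e] := lifts_eigen lg1 f1a; have [y1 _ g1h] := lifts_eigen lg1 f1b.
have [x2 _ g2e] := lifts_eigen lg2 f2a; have [y2 _ g2h] := lifts_eigen lg2 f2b.
have LE : (val L = <[e]> + <[h]>)%VS.
  apply/eqP; rewrite eq_sym eqEdim subv_add -!memvE eL hL /=.
  rewrite dimv_disjoint_sum; last by rewrite -aE -bE point_cap.
  by rewrite !dim_vline e0 h0 (eqP (valP L)).
move=> p; apply: val_inj; rewrite /= !lg1 !lg2 lg1.
have [v vL [_ ->]] := pointP p; have [x [y ->]] := line_coords LE vL.
rewrite !limg_line; congr <[_]>%VS.
rewrite !(linearD, linearZ) /= g1e g1h g2e g2h !linearZ /= g1e g1h g2e g2h.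
by rewrite !scalerA; congr (_ *: _ + _ *: _); ring.
Qed.

(** * Rotation and reflection in the dihedral group *)

Lemma dihedral_generators (n : nat) : (3 <= n)%N ->
  exists x y : 'D_(n.*2),
    [/\ (x ^+ n = 1)%g, (x * y != y * x)%g & forall g, (x ^ g)%g \in <[x]>%g].
Proof.
move=> n3; have n1 : (1 < n)%N by exact: ltnW.
have /(isoGrpP _ (Grp_dihedral n1))[_] := isog_refl [set: 'D_(n.*2)]%G.
case/existsP=> -[x y] /= /eqP[defG xn y2 xy].
have {}defG : (<[x]> * <[y]>)%g = [set: 'D_(n.*2)].
  by rewrite -norm_joinEr // norms_cycle xy groupV cycle_id.
exists x, y; split=> // [|g].
  (* If [x] and [y] commute, then x = x^-1, so both cyclic groups have order at most 2 and 2n <=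
     4. *)
  apply/eqP => e; have xV : (x = x^-1)%g by rewrite -xy conjgE e mulKg.
  have x2 : (x ^+ 2 = 1)%g by rewrite expgS expg1 {1}xV mulVg.
  have := mul_cardG <[x]>%G <[y]>%G; rewrite defG card_dihedral //.
  have ox : (#|<[x]>%g| <= 2)%N by rewrite dvdn_leq // order_dvdn x2.
  have oy : (#|<[y]>%g| <= 2)%N by rewrite dvdn_leq // order_dvdn y2.
  move=> cE; have := leq_mul ox oy; rewrite cE => c.
  have : (n.*2 * 1 <= 2 * 2)%N.
    by apply: leq_trans c; rewrite leq_mul2l cardG_gt0 orbT.
  by rewrite muln1 leqNgt => /negP[]; rewrite -(ltn_double 2) in n3.
have : g \in (<[x]> * <[y]>)%g by rewrite defG inE.
suff s : (<[x]> * <[y]> \subset 'N(<[x]>))%g.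
  by move=> /(subsetP s) gN; rewrite memJ_norm // cycle_id.
by rewrite mul_subG ?normG // norms_cycle xy groupV cycle_id.
Qed.

(** * Transport of special points along the groupoid *)

Section Arrows.
Variables (K : fieldType) (Ls : {fset line K}).
Implicit Types (L M N Li Lj Lk Ll : line K).

Lemma arrow_lifts L M (f : point L -> point M) :
  arrow Ls f -> exists g, lifts f g.
Proof.
elim=> {L M f} [Li Lj Lk h _ _ _|L _|L M N f g _ [f' lf] _ [g' lg]].
- by exists (daddv_pi (val Lj) (val Lk)); apply: line_proj_lifts.
- by exists \1%VF; apply: lifts_id.
- by exists (g' \o f')%VF; apply: lifts_comp lf lg.
Qed.

Lemma arrow_inv L M (f : point L -> point M) :
  arrow Ls f -> exists f', [/\ arrow Ls f', cancel f f' & cancel f' f].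
Proof.
elim=> {L M f} [Li Lj Lk h iLs jLs kLs|L LLs|L M N f g _ [f' [af fK f'K]] _
    [g' [ag gK g'K]]].
- have h' := skew3_swap12 h; exists (line_proj h').
  by split; [apply: arrow_proj | apply: line_projK | apply: line_projK].
- by exists id; split=> //; apply: arrow_id.
- exists (f' \o g'); split; first exact: arrow_comp ag af.
    exact: can_comp.
  exact: can_comp.
Qed.

(** This is a reductio: the conclusion contradicts the loop sending [a] to [b]. The orbit of [a] has
    at most two points on each line, so [line_proj_indep] applies and the arrows select one of them
    consistently. *)
Lemma pairwise_skew_vertex_fix L (a b : point L) :
  pairwise_skew Ls -> L \in Ls -> a != b ->
  (forall f, arrow Ls f -> f a = a \/ f a = b) ->
  (exists2 f, arrow Ls f & f a = b) ->
  forall f : point L -> point L, arrow Ls f -> f a = a.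
Proof.
move=> sk LLs ab orb [s as_ sa].
pose S M (p : point M) := exists2 f : point L -> point M, arrow Ls f & p = f a.
have Scl M N P (h : skew3 M N P) r : M \in Ls -> N \in Ls -> P \in Ls ->
    S M r -> S N (line_proj h r).
  move=> MLs NLs PLs [f af ->]; exists (line_proj h \o f) => //.
  exact: arrow_comp af (arrow_proj h MLs NLs PLs).
(* Pulling back along the inverse of an arrow reduces the count on [M] to the orbit of [a] on
   [L]. *)
have S2 M (p q r : point M) : S M p -> S M q -> S M r -> p != q ->
    r = p \/ r = q.
  case=> f af -> [g ag ->] [h ah ->] fg.
  have [f' [af' fK f'K]] := arrow_inv af.
  have [g1|g1] := orb _ (arrow_comp ag af').
    by case/eqP: fg; rewrite -[g a]f'K [f' _]g1.
  have [h1|h1] := orb _ (arrow_comp ah af'); [left|right].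
    by rewrite -[h a]f'K [f' _]h1.
  by rewrite -[h a]f'K -[g a]f'K [f' (g a)]g1 [f' _]h1.
have Sne M (p : point M) : S M p -> exists2 q, S M q & p != q.
  case=> f af ->; exists (f b).
    by exists (f \o s); [exact: arrow_comp as_ af | rewrite /= sa].
  have [f' [_ fK _]] := arrow_inv af.
  by rewrite (inj_eq (can_inj fK)).
have indep Li Lj Lk Ll (hk : skew3 Li Lj Lk) (hl : skew3 Li Lj Ll)
    (p : point Li) :
    Li \in Ls -> Lj \in Ls -> Lk \in Ls -> Ll \in Ls -> S Li p ->
    line_proj hk p = line_proj hl p.
  move=> iLs jLs kLs lLs Sp; have [q Sq pq] := Sne _ _ Sp.
  exact: (line_proj_indep hk hl Scl S2 sk iLs jLs kLs lLs Sp Sq pq).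
(* [T L] holds at [a] only, and over [M <> L] at the common value of the
   [f_LMk a]; it is stable under the groupoid. *)
pose T M (p : point M) := [/\ S M p, (M = L -> val p = val a) &
  forall k (h : skew3 L M k), k \in Ls -> p = line_proj h a].
have ska k (h : skew3 L L k) : False.
  by case/and3P: h; rewrite skew_lines_irrefl.
suff Tcl M N (f : point M -> point N) :
    arrow Ls f -> forall p, T M p -> T N (f p).
  move=> f af; apply: val_inj.
  have [] // := Tcl _ _ _ af a; last by move=> _ ->.
  by split=> // [|k h]; [exists id => //; exact: arrow_id | case: (ska _ h)].
have Sa : S L a by exists id => //; exact: arrow_id.
elim=> {M N f} [M N k h MLs NLs kLs p|//|
    M N P f g _ IHf _ IHg p Tp]; last first.
  exact/IHg/IHf.
case=> Sp pa pk; split; first exact: Scl.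
  move=> NL; subst N; congr val.
  by rewrite (pk _ (skew3_swap12 h)) // line_projK.
move=> l h' lLs; have [ML|ML] := eqVneq M L.
  subst M; rewrite (val_inj (pa erefl)); exact: indep.
have hML : skew3 M N L.
  case/and3P: (h) => MN _ _; case/and3P: (h') => LN _ _.
  by rewrite /skew3 MN sk // skew_lines_sym.
have hL := skew3_swap12 (skew3_swap23 hML).
(* The third line [k] may be replaced by [L]; then f_MNL after f_LMN is f_LNM, whose value at [a]
   does not depend on the third line. *)
rewrite (indep _ _ _ _ h hML) // (pk _ hL) //.
rewrite (line_proj_comp _ _ (skew3_swap23 hL)); exact: indep.
Qed.

End Arrows.

(** * The contradiction for dihedral vertex groups *)

Theorem theorem4p3 (K : closedFieldType) (n : nat) (n_ge3 : (3 <= n)%N)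
    (char_ndvd : forall p : nat, p \in [pchar K] -> ~~ (p %| n)%N) :
  ~ exists Ls : {fset line K},
      [/\ (3 <= #|` Ls|)%N, pairwise_skew Ls &
          exists2 L : line K, L \in Ls & vertex_group_isog Ls L 'D_(n.*2)].
Proof.
case=> Ls [_ sk [L LLs [phi [phi_inj phiM phiP]]]].
have phi_arrow x : arrow Ls (phi x) by apply/phiP; exists x.
have phi1 : phi 1%g = id.
  (* As [id] is some [phi x], multiplicativity at 1 * x gives phi 1 = phi x. *)
  have [x xE] := (phiP id).1 (arrow_id LLs).
  by have := phiM 1%g x; rewrite mul1g -xE.
have phiX x k : phi (x ^+ k)%g =1 iter k (phi x).
  by elim: k => [|k IH] p; rewrite ?expg0 ?phi1 // expgS phiM /= IH.
have [x [y [xn xy xN]]] := dihedral_generators n_ge3.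
have n0 : n%:R != 0 :> K.
  apply/negP => e; have [p pK] := natf0_pchar (ltnW (ltnW n_ge3)) e.
  by case/negP: (char_ndvd p pK); rewrite (dvdn_pcharf pK) e.
have phi_neq g h : g <> h -> ~ phi g =1 phi h.
  by move=> gh e; apply/gh/phi_inj/functional_extensionality.
have x1 : ~ phi x =1 id.
  rewrite -phi1; apply: phi_neq => x1.
  by move: xy; rewrite x1 mul1g mulg1 eqxx.
have [g lg] := arrow_lifts (phi_arrow x).
have xnE : iter n (phi x) =1 id by move=> p; rewrite -phiX xn phi1.
have [a [b [ab xa xb fixP]]] := finite_order_fixed_pair lg n0 xnE x1.
(* [<[x]>] is normal, so every element permutes the fixed points of [x]. *)
have orb h p : phi x p = p -> phi h p = a \/ phi h p = b.
  move=> xp; apply: fixP; have /cycleP[k xhE] := xN h.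
  have := congr1 (fun u => phi u p) (conjgC x h).
  rewrite xhE !phiM /= phiX => ->; congr (phi h _).
  by elim: k {xhE} => //= k ->.
(* Either some element sends [c] to [d] and [pairwise_skew_vertex_fix] applies, or none does and [c]
   is fixed outright. *)
have fix_all c d h : c != d -> (forall u, phi u c = c \/ phi u c = d) ->
    phi h c = c.
  move=> cd cP; have [/existsP[s /eqP sc]|] := boolP [exists s, phi s c == d].
    apply: (pairwise_skew_vertex_fix sk LLs cd) (phi_arrow h).
      by move=> f /phiP[u ->].
    by exists (phi s).
  by rewrite negb_exists => /forallP/(_ h)/eqP; case: (cP h).
have fa h : phi h a = a by apply: (fix_all a b) => // u; exact: orb.
have fb h : phi h b = b.
  apply: (fix_all b a); first by rewrite eq_sym.
  by move=> u; case: (orb u b xb) => ->; [right|left].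
have [g' lg'] := arrow_lifts (phi_arrow y).
apply: (phi_neq (x * y)%g (y * x)%g); first exact/eqP.
by rewrite !phiM; apply: lifts_common_fixed_comm lg lg' ab _ _ _ _.
Qed.
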